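(* Assume that the MDS conjecture holds. Let $q$ be a prime power and let $C$ be a nontrivial MDS $[q+1,k,q-k+2]_q$ code. Then $C$ is not uniformly packed in the wide sense (and so not completely regular), with the following exceptions: (i) $k=q-1$, in which case $C$ is a Hamming code, and is perfect and completely regular. (ii) $k=2$ with $q$ even or $q=3$, in which case $C$ is uniformly packed in the wide sense. For $q=3$, $C$ is also completely regular. (iii) $k=q-2$ with $q$ even, in which case $C$ is uniformly packed in the wide sense. Moreover, for any $m>1$, there exists a completely regular $[q+1,q-2,4]_q$ code, where $q=2^m$.
   Context: $\mathbb{F}_q$ is the finite field of order $q$. An $[n,k,d]_q$ code $C$ is a $k$-dimensional linear subspace of $\mathbb{F}_q^n$ with minimum Hamming distance $d$. $C$ is MDS if $d=n-k+1$; an MDS $[n,k,d]_q$ code is nontrivial if $2\le k\le n-2$. The MDS conjecture is the statement: for every prime power $q$, if $C$ is a nontrivial MDS $[n,k,d]_q$ code, then $n\le q+1$ unless $q$ is even and $k=3$ or $k=q-1$, in which case $n\le q+2$. For $\mathbf{v}\in\mathbb{F}_q^n$, $d(\mathbf{v},C)=\min\{d(\mathbf{v},\mathbf{x}) : \mathbf{x}\in C\}$ (Hamming distance), and for $t\in\{0,\dots,n\}$, $B_{\mathbf{v},t}=|\{\mathbf{x}\in C : d(\mathbf{v},\mathbf{x})=t\}|$. The covering radius is $\rho=\max_{\mathbf{v}\in\mathbb{F}_q^n} d(\mathbf{v},C)$, and the packing radius is $e=\lfloor (d-1)/2\rfloor$; $C$ is perfect if $e=\rho$. Hamming codes are the linear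 perfect codes with $e=1$; they have parameters $[n,n-m,3]_q$ with $n=(q^m-1)/(q-1)$, $m\ge 2$. $C$ is completely regular if $B_{\mathbf{v},t}$ depends only on $t$ and $d(\mathbf{v},C)$. $C$ is uniformly packed in the wide sense if there exist rational numbers $\beta_0,\dots,\beta_\rho$ such that $\sum_{i=0}^{\rho}\beta_i B_{\mathbf{x},i}=1$ for every $\mathbf{x}\in\mathbb{F}_q^n$. *)

(* Defs.v *)
From mathcomp Require Import all_boot all_order all_algebra all_field.

Set Implicit Arguments.
Unset Strict Implicit.
Unset Printing Implicit Defensive.

Import GRing.Theory.

Section Codes.

(* F is the field of order q = #|F|; a linear code of length n over F is a
   subspace of 'rV[F]_n. *)
Variables (F : finFieldType) (n : nat).
Implicit Types (x y v w : 'rV[F]_n) (C : {vspace 'rV[F]_n}).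

Definition hdist x y : nat := #|[set i : 'I_n | x ord0 i != y ord0 i]|.

(* Distances are at most n, so the default value n of the minimum only matters
   for the zero code, which has no two distinct words. *)
Definition min_dist C : nat :=
  \big[minn/n]_(p : 'rV[F]_n * 'rV[F]_n
                | [&& p.1 \in C, p.2 \in C & p.1 != p.2]) hdist p.1 p.2.

(* C is an [n, k, d]_q code. *)
Definition is_code C (k d : nat) : Prop := \dim C = k /\ min_dist C = d.

(* No truncation occurs, since \dim C <= n. *)
Definition MDS C : Prop := min_dist C = n - \dim C + 1.

Definition nontrivial_MDS C : Prop := MDS C /\ 2 <= \dim C <= n - 2.

(* The default value n is harmless: C contains 0 and distances are <= n. *)
Definition dist_to_code v C : nat := \big[minn/n]_(x | x \in C) hdist v x.

Definition B C v (t : nat) : nat := #|[set x | (x \in C) && (hdist v x == t)]|.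

Definition covering_radius C : nat := \max_(v : 'rV[F]_n) dist_to_code v C.

Definition packing_radius C : nat := (min_dist C - 1) %/ 2.

Definition perfect C : Prop := packing_radius C = covering_radius C.

Definition Hamming_code C : Prop := perfect C /\ packing_radius C = 1.

Definition completely_regular C : Prop :=
  forall v w (t : nat), t <= n ->
    dist_to_code v C = dist_to_code w C -> B C v t = B C w t.

Definition uniformly_packed C : Prop :=
  exists beta : 'I_(covering_radius C).+1 -> rat,
    forall x, (\sum_i beta i * (B C x i)%:R = 1)%R.

End Codes.

(* Finite fields of every prime power order exist and are unique up to
   isomorphism, so quantifying over all F amounts to quantifying over all
   prime powers q = #|F|. *)
Definition MDS_conjecture : Prop :=
  forall (F : finFieldType) (n k d : nat) (C : {vspace 'rV[F]_n}),
    is_code C k d -> nontrivial_MDS C ->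
    if ~~ odd #|F| && ((k == 3) || (k == #|F| - 1)) then n <= #|F| + 2
    else n <= #|F| + 1.

(* Main.v *)
Require Import Defs.
From mathcomp Require Import all_boot all_order all_algebra all_field.
From mathcomp Require Import zify ring.

Set Implicit Arguments.
Unset Strict Implicit.
Unset Printing Implicit Defensive.

Import GRing.Theory Num.Theory.

(** Write [n = q + 1] for the length and [k] for the dimension of [C].

    An MDS code is interpolating: any prescribed values on at most [k]
    coordinates are taken by a codeword, uniquely so on exactly [k] coordinates
    ([mds_interpolation]).  Counting the codewords that agree with a vector [x]
    off sets of size [j] gives linear relations between the numbers [B C x i]
    whose right-hand sides do not depend on [x] as soon as [j >= n - k]
    ([sum_agree_off], [agree_off_const]).  They have two consequences.

    - The relation for [j = n - k] only involves the distances [i <= n - k].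
      If the covering radius reaches [n - k], this relation is a uniform
      packing ([mds_uniformly_packed]).
    - The relations together are triangular and express every [B C x i] through
      those with [i < n - k] ([mds_B_determined]).  For [k = q - 1] and
      [k = q - 2] only the distances below 2, respectively 3, remain to be
      controlled in order to prove complete regularity.

    Complete regularity implies uniform packing
    ([completely_regular_uniformly_packed]), so it suffices to refute uniform
    packing in the generic case.  There the MDS conjecture bounds the covering
    radius: a vector at distance [n - k] or more from [C] would extend [C] to an
    MDS code of length [q + 2], which is only possible for [q] even and
    [k = 2] or [k = q - 2] ([covering_radius_lt_redundancy]).  On the other hand
    the dual code has words of all the [n - k] weights [k + 1, ..., n] unless
    [k = q - 1] ([mds_dual_weights]).  A uniform packing amounts to a nonzero
    polynomial of degree at most the covering radius that vanishes at the
    number of zero coordinates of each dual word, and there are too many such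
    numbers ([not_uniformly_packed]).

    The exceptional cases are treated as follows.

    - [k = q - 1]: the radius-one balls cover by a pigeonhole argument
      ([redundancy2_covering_radius]).
    - [k = 2], [q] even: if [g] and [h] span [C], the vector with coordinates
      [sqrt (g_i h_i)] is at distance [n - 2] from [C]; geometrically, a conic
      together with its nucleus is a hyperoval
      ([even_dim2_covering_radius]).
    - [k = q - 2], [q] even: the columns of a parity check matrix form an arc of
      [q + 1] points in a projective plane of even order, where each point of a
      secant off the arc lies on exactly one tangent.  Hence every vector at
      distance 2 from [C] has exactly [q / 2] codewords at distance 2
      ([double_B2_eq]), and each such code is completely regular.  The doubly
      extended Reed-Solomon code is an example. *)

(** * Counting subsets *)

(** The default value [N] is not neutral for [minn], hence the first conjunct. *)
Lemma leq_bigminP (I : finType) (P : pred I) (f : I -> nat) (N d : nat) :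
  reflect (d <= N /\ forall i, P i -> d <= f i) (d <= \big[minn/N]_(i | P i) f i).
Proof. exact: (@Order.TotalTheory.bigmin_geP _ nat I N d P f). Qed.

Lemma exists_superset (T : finType) (A : {set T}) (j : nat) :
  #|A| <= j <= #|T| -> exists2 J : {set T}, A \subset J & #|J| = j.
Proof.
case/andP=> leAj lejT.
have : 0 < #|[set B : {set T} | B \subset ~: A & #|B| == #|T| - j]|.
  by rewrite cards_draws bin_gt0 cardsCs setCK leq_sub2l.
case/card_gt0P=> K; rewrite inE => /andP[sKA /eqP cK].
exists (~: K); first by rewrite -[A]setCK setCS.
by rewrite cardsCs setCK cK subKn.
Qed.

Lemma card_supersets (T : finType) (A : {set T}) (j : nat) : j <= #|T| ->
  #|[set J : {set T} | A \subset J & #|J| == j]| = 'C(#|T| - #|A|, #|T| - j).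
Proof.
move=> lejT; rewrite (_ : #|T| - #|A| = #|~: A|) ?[RHS]cardsCs ?setCK //.
rewrite -cards_draws -(card_imset _ (@setC_inj T)).
apply: eq_card => K; apply/imsetP/idP => [[J]|]; rewrite !inE.
  by case/andP=> sAJ /eqP <- ->; rewrite setCS sAJ cardsCs setCK eqxx.
case/andP=> sKA /eqP cK; exists (~: K); last by rewrite setCK.
by rewrite inE -[A]setCK setCS sKA cardsCs setCK cK subKn ?eqxx.
Qed.

(** * Hamming weights and distances to a code *)

Section Weights.

Variables (F : finFieldType) (n : nat).
Implicit Types (x y v w e c u : 'rV[F]_n) (C : {vspace 'rV[F]_n}).
Implicit Types (J : {set 'I_n}).

Definition supp x : {set 'I_n} := [set i | x ord0 i != 0%R].

Definition wt x : nat := #|supp x|.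

Lemma in_supp x i : (i \in supp x) = (x ord0 i != 0%R).
Proof. by rewrite inE. Qed.

Lemma notin_supp x J i : supp x \subset J -> i \notin J -> x ord0 i = 0%R.
Proof.
move=> /subsetP sJ iJ; apply/eqP; apply: contraNT iJ => xi.
by apply: sJ; rewrite in_supp.
Qed.

Lemma supp_subP x J :
  reflect (forall i, i \notin J -> x ord0 i = 0%R) (supp x \subset J).
Proof.
apply: (iffP idP) => [sJ i|x0]; first exact: notin_supp.
by apply/subsetP=> i; rewrite in_supp; apply: contraNT => /x0->.
Qed.

Lemma hdistE x y : hdist x y = wt (x - y)%R.
Proof. by apply: eq_card => i; rewrite !inE !mxE subr_eq0. Qed.

Lemma supp_eq0 x : (supp x == set0) = (x == 0%R).
Proof.
apply/eqP/eqP => [s0|->]; last by apply/setP=> i; rewrite !inE mxE eqxx.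
apply/rowP=> i; rewrite mxE; apply/eqP; apply: contraTT isT => xi.
by have := in_supp x i; rewrite s0 inE xi.
Qed.

Lemma wt_eq0 x : (wt x == 0) = (x == 0%R).
Proof. by rewrite -supp_eq0 cards_eq0. Qed.

Lemma wt_le x : wt x <= n.
Proof. by rewrite -[X in _ <= X](card_ord n) max_card. Qed.

Lemma suppN x : supp (- x)%R = supp x.
Proof. by apply/setP=> i; rewrite !inE mxE oppr_eq0. Qed.

Lemma wtN x : wt (- x)%R = wt x.
Proof. by rewrite /wt suppN. Qed.

Lemma supp_add x y J :
  supp x \subset J -> supp y \subset J -> supp (x + y)%R \subset J.
Proof.
move=> sx sy; apply/supp_subP=> i iJ.
by rewrite mxE (notin_supp sx) // (notin_supp sy) // addr0.
Qed.

Lemma supp_sub x y J :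
  supp x \subset J -> supp y \subset J -> supp (x - y)%R \subset J.
Proof. by move=> sx sy; apply: supp_add => //; rewrite suppN. Qed.

Lemma wtD x y : wt (x + y)%R <= wt x + wt y.
Proof.
apply: leq_trans (leq_card_setU (supp x) (supp y)).
by apply: subset_leq_card; rewrite supp_add ?subsetUl ?subsetUr.
Qed.

Lemma hdistC x y : hdist x y = hdist y x.
Proof. by rewrite !hdistE -wtN opprB. Qed.

Lemma hdist_triangle y x z : hdist x z <= hdist x y + hdist y z.
Proof. by rewrite !hdistE; have := wtD (x - y) (y - z)%R; rewrite addrA subrK. Qed.

Lemma supp_delta (i : 'I_n) : supp (delta_mx ord0 i) = [set i].
Proof.
by apply/setP=> j; rewrite !inE mxE eqxx /=; case: (j == i); rewrite ?oner_eq0 ?eqxx.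
Qed.

Lemma card_supp_sub J : #|[set e | supp e \subset J]| = #|F| ^ #|J|.
Proof.
rewrite -(@card_pffun_on _ F 0%R (mem J) predT).
pose f (e : 'rV[F]_n) : {ffun 'I_n -> F} := [ffun i => e ord0 i].
have f_inj : injective f.
  by move=> x y /ffunP fxy; apply/rowP=> i; have := fxy i; rewrite !ffunE.
rewrite -(card_imset _ f_inj); apply: eq_card => g.
apply/imsetP/pffun_onP => [[e]|[sg _]].
  rewrite inE => /supp_subP se ->; split=> //.
  by apply/supportP=> i iJ; rewrite ffunE se.
exists (\row_i g i)%R; last by apply/ffunP=> i; rewrite ffunE mxE.
by rewrite inE; apply/supp_subP=> i iJ; rewrite mxE; apply: (supportP sg).
Qed.

Lemma min_dist_geP C d : d <= n ->
  reflect (forall c, c \in C -> c != 0%R -> d <= wt c) (d <= min_dist C).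
Proof.
move=> ledn; apply: (iffP (leq_bigminP _ _ _ _)) => [[_ leC] c cC c0 | leC].
  by have := leC (c, 0%R) => /=; rewrite cC mem0v c0 hdistE subr0; apply.
split=> // -[x y] /= /and3P[xC yC xy].
by rewrite hdistE leC ?memvB // subr_eq0.
Qed.

Lemma dist_le v C x : x \in C -> dist_to_code v C <= hdist v x.
Proof. by move=> xC; have /leq_bigminP[_] := leqnn (dist_to_code v C); apply. Qed.

Lemma dist_geP v C d : d <= n ->
  reflect (forall x, x \in C -> d <= hdist v x) (d <= dist_to_code v C).
Proof.
by move=> ledn; apply: (iffP (leq_bigminP _ _ _ _)) => [[_]|] leC; [|split].
Qed.

Lemma dist_ltn v C d :
  dist_to_code v C < d -> exists2 x, x \in C & hdist v x < d.
Proof.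
case: (boolP [exists x in C, hdist v x < d]) => [/exists_inP|]; first by [].
rewrite negb_exists_in => /forall_inP geC; have [ledn|ltnd] := leqP d n.
  rewrite ltnNge => /negP[]; apply/dist_geP => // x xC.
  by rewrite leqNgt geC.
by have := geC 0%R (mem0v _); rewrite hdistE (leq_ltn_trans (wt_le _)).
Qed.

Lemma dist_attained v C : exists2 x, x \in C & hdist v x = dist_to_code v C.
Proof.
have [x xC ltx] := @dist_ltn v C _ (ltnSn _); exists x => //.
by apply/eqP; rewrite eqn_leq -ltnS ltx dist_le.
Qed.

Lemma dist_le_covering v C : dist_to_code v C <= covering_radius C.
Proof. exact: leq_bigmax. Qed.

Lemma dist_le_n v C : dist_to_code v C <= n.
Proof.
by have := dist_le v (mem0v C); rewrite hdistE => /leq_trans-> //; apply: wt_le.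
Qed.

Lemma covering_radius_le C r :
  (forall v, dist_to_code v C <= r) -> covering_radius C <= r.
Proof. by move=> le_r; apply/bigmax_leqP. Qed.

Lemma B_translate C v c t : c \in C -> B C (v - c)%R t = B C v t.
Proof.
move=> cC; rewrite /B -(card_imset _ (addIr c)).
apply: eq_card => y; apply/imsetP/idP => [[x]|]; rewrite !inE.
  case/andP=> xC /eqP <- ->; rewrite memvD // !hdistE.
  by rewrite opprD [(- x - c)%R]addrC addrA eqxx.
case/andP=> yC /eqP dy; exists (y - c)%R; last by rewrite subrK.
by rewrite inE memvB // -dy !hdistE opprB addrA subrK eqxx.
Qed.

Lemma B_below_dist C v t : t < dist_to_code v C -> B C v t = 0.
Proof.
move=> lt_t; apply/eqP; rewrite cards_eq0; apply/eqP/setP=> x; rewrite !inE.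
apply/negP=> /andP[xC /eqP dx]; move: lt_t.
by rewrite -dx ltnNge dist_le.
Qed.

Lemma B_dist_gt0 C v : 0 < B C v (dist_to_code v C).
Proof.
by have [x xC dx] := dist_attained v C; apply/card_gt0P; exists x; rewrite inE xC dx eqxx.
Qed.

(** Two codewords at distances whose sum is less than the minimum distance
    coincide, so the nearest codeword is the only one that is this close. *)
Lemma B_within_min_dist C v t : t + dist_to_code v C < min_dist C ->
  B C v t = (t == dist_to_code v C).
Proof.
move=> ltd; have [x xC dx] := dist_attained v C.
have le_d y : y \in C -> y != x -> min_dist C <= hdist y x.
  move=> yC yx; have /leq_bigminP[_ /(_ (y, x))] := leqnn (min_dist C).
  by rewrite /= yC xC yx; apply.
have only y : y \in C -> hdist v y = t -> y = x.
  move=> yC dy; apply/eqP; apply: contraLR ltd => /le_d-/(_ yC).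
  rewrite -leqNgt => /leq_trans-> //.
  by rewrite (leq_trans (hdist_triangle v y x)) // hdistC dy dx.
case: eqP => [et|ne].
  apply/eqP/cards1P; exists x; apply/setP=> y; rewrite !inE.
  apply/andP/eqP => [[yC /eqP dy]|->]; first exact: only.
  by rewrite xC dx et.
apply/eqP; rewrite cards_eq0; apply/eqP/setP=> y; rewrite !inE.
by apply/andP=> -[yC /eqP dy]; apply: ne; rewrite -dy (only y) // dx.
Qed.

Lemma sum_B C x (f : nat -> nat) :
  \sum_(i < n.+1) B C x i * f i = \sum_(c in C) f (hdist x c).
Proof.
have lt c : hdist x c < n.+1 by rewrite ltnS hdistE wt_le.
rewrite (partition_big (fun c => Ordinal (lt c)) predT) //=.
apply: eq_bigr => i _; rewrite -sum_nat_const; apply: eq_big => [c|c].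
  by rewrite inE.
by rewrite inE => /andP[_ /eqP->].
Qed.

End Weights.

(** * Interpolation and the distance distribution of MDS codes *)

Section MDSCodes.

Variables (F : finFieldType) (n : nat).
Implicit Types (x y v w e c u : 'rV[F]_n) (C : {vspace 'rV[F]_n}).
Implicit Types (J : {set 'I_n}).

(** The MDS property as a lower bound on weights. By linearity it determines the
    minimum distance, except for the zero code; see [MDS_mds] and [mds_MDS]. *)
Definition weight_mds C : Prop :=
  forall c, c \in C -> c != 0%R -> n - \dim C < wt c.

Lemma dim_le_length C : \dim C <= n.
Proof. by rewrite (leq_trans (dimvS (subvf C))) // dimvf /dim /= mul1n. Qed.

Lemma mds_eq0 C c : weight_mds C -> c \in C -> wt c <= n - \dim C -> c = 0%R.
Proof.
move=> mC cC; rewrite leqNgt => le_c; apply/eqP; apply: contraNT le_c.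
exact: mC.
Qed.

Lemma MDS_mds C : 0 < \dim C -> MDS C -> weight_mds C.
Proof.
move=> k_gt0 dC; have le_kn := dim_le_length C.
have : min_dist C <= min_dist C by [].
rewrite {1}dC addn1 => /min_dist_geP H c cC c0; apply: H => //.
by lia.
Qed.

(** Restriction to the complement of [J] is injective on [C] when [J] has
    [n - k] elements, as the difference of two codewords with the same image
    has weight at most [n - k].  Both sides have [q ^ k] elements, so it is
    also onto. *)
Lemma mds_interpolation C J x : weight_mds C -> n - \dim C <= #|J| ->
  exists2 c, c \in C & supp (x - c)%R \subset J.
Proof.
move=> mC; have le_kn := dim_le_length C.
(* A larger [J] may be shrunk to size [n - k]. *)
wlog cJ : J / #|J| = n - \dim C => [IH leJ|_].
  have [|K sJK cK] := @exists_superset _ (~: J) (\dim C).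
    by rewrite cardsCs setCK card_ord; lia.
  have [||c cC sc] := IH (~: K); rewrite ?[#|~: K|]cardsCs ?setCK ?cK ?card_ord //.
  by exists c => //; apply: subset_trans sc _; rewrite -[J]setCK setCS.
pose r (c : 'rV[F]_n) := (\row_i if i \in J then 0 else c ord0 i)%R.
have r_inj : {in C &, injective r}.
  move=> c d cC dC /rowP rcd; apply/eqP; rewrite -subr_eq0; apply/eqP.
  apply: (mds_eq0 mC); rewrite ?memvB // -cJ subset_leq_card //.
  apply/supp_subP=> i /negPf iJ; have := rcd i; rewrite !mxE iJ => ->.
  by rewrite subrr.
have : r x \in [set e | supp e \subset ~: J].
  by rewrite inE; apply/supp_subP=> i; rewrite inE negbK mxE => ->.
suffices <- : [set r c | c in C] = [set e | supp e \subset ~: J].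
  case/imsetP=> c cC /rowP rxc; exists c => //; apply/supp_subP=> i /negPf iJ.
  by have := rxc i; rewrite !mxE iJ => ->; rewrite subrr.
apply/eqP; rewrite eqEcard; apply/andP; split.
  apply/subsetP=> _ /imsetP[c _ ->]; rewrite inE; apply/supp_subP=> i.
  by rewrite inE negbK mxE => ->.
rewrite (card_in_imset r_inj) card_vspace card_supp_sub [#|~: J|]cardsCs setCK.
by rewrite cJ card_ord subKn.
Qed.

(** A code all of whose nonzero words are heavy attains the Singleton bound,
    because interpolation on one information set produces a word of weight at
    most [n - k + 1]. *)
Lemma mds_MDS C : 0 < \dim C -> weight_mds C -> MDS C.
Proof.
move=> k_gt0 mC; have le_kn := dim_le_length C; rewrite /MDS addn1.
have ltn : n - \dim C < n by rewrite ltn_subrL k_gt0 (leq_trans k_gt0).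
apply/eqP; rewrite eqn_leq; apply/andP; split; last exact/min_dist_geP.
pose i0 := Ordinal (leq_trans k_gt0 le_kn).
have [|J0 sJ cJ] := @exists_superset _ [set i0] (n - \dim C).+1.
  by rewrite cards1 card_ord.
have i0J : i0 \in J0 by rewrite -sub1set.
have [|c cC sc] := @mds_interpolation C (J0 :\ i0) (delta_mx ord0 i0) mC.
  by have := cardsD1 i0 J0; rewrite i0J cJ => -[->].
have c_i0 : c ord0 i0 = 1%R.
  have /eqP := notin_supp sc (negbT (setD11 _ _)).
  by rewrite !mxE !eqxx subr_eq0 => /eqP.
have c_neq0 : c != 0%R.
  by apply/eqP=> c0; have /eqP := c_i0; rewrite c0 mxE eq_sym oner_eq0.
have sc0 : supp c \subset J0.
  rewrite -[c](subKr (delta_mx ord0 i0)) supp_sub ?supp_delta //.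
  exact: subset_trans sc (subsetDl _ _).
have /leq_bigminP[_ /(_ (c, 0%R))] := leqnn (min_dist C).
rewrite /= cC mem0v c_neq0 hdistE subr0 => /(_ isT) /leq_trans-> //.
by rewrite -cJ subset_leq_card.
Qed.

Definition agree_off C J x :=
  #|[set c | (c \in C) && (supp (x - c)%R \subset J)]|.

(** Double counting of the pairs of a codeword and a set of size [j] off which
    it agrees with [x]: a codeword at distance [i] has a difference with support
    of size [i], which lies in [C(n - i, n - j)] sets of size [j]. *)
Lemma sum_agree_off C x j : j <= n ->
  \sum_(J : {set 'I_n} | #|J| == j) agree_off C J x =
  \sum_(i < n.+1) B C x i * 'C(n - i, n - j).
Proof.
move=> lejn; rewrite (sum_B C x (fun i => 'C(n - i, n - j))).
rewrite (eq_bigr (fun J : {set 'I_n} => \sum_(c in C | supp (x - c)%R \subset J) 1)).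
  rewrite (exchange_big_dep (mem C)) /=; last by move=> J c _ /andP[].
  apply: eq_bigr => c cC; rewrite sum1dep_card hdistE -[n in n - wt _]card_ord.
  rewrite -[n in n - j]card_ord -card_supersets ?card_ord //.
  by apply: eq_card => J; rewrite !inE cC andbC.
by move=> J _; rewrite sum1dep_card.
Qed.

Lemma agree_off_translate C J x c :
  c \in C -> agree_off C J (x - c)%R = agree_off C J x.
Proof.
move=> cC; rewrite /agree_off -(card_imset _ (addIr c)).
apply: eq_card => y; apply/imsetP/idP => [[d]|]; rewrite !inE.
  by case/andP=> dC sd ->; rewrite memvD //= opprD [(- d - c)%R]addrC addrA.
case/andP=> yC sy; exists (y - c)%R; last by rewrite subrK.
by rewrite inE memvB //= opprB addrA subrK.
Qed.

(** Interpolation replaces [x] by a vector supported in [J], and translation by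
    such a vector does not change agreement off [J]. *)
Lemma agree_off_const C J x : weight_mds C -> n - \dim C <= #|J| ->
  agree_off C J x = agree_off C J 0%R.
Proof.
move=> mC leJ; have [c cC sc] := mds_interpolation x mC leJ.
rewrite -(agree_off_translate J x cC); apply: eq_card => d; rewrite !inE.
case: (d \in C) => //=; rewrite sub0r suppN; apply/idP/idP => sd.
  by rewrite -[d](subKr (x - c)%R) supp_sub.
exact: supp_sub.
Qed.

Lemma agree_off1 C J x : weight_mds C -> #|J| = n - \dim C -> agree_off C J x = 1.
Proof.
move=> mC cJ; rewrite agree_off_const ?cJ //.
apply/eqP/cards1P; exists 0%R; apply/setP=> c; rewrite !inE sub0r suppN.
apply/andP/eqP => [[cC sc]|->]; last first.
  by rewrite mem0v; split=> //; apply/supp_subP=> i; rewrite mxE.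
by apply: (mds_eq0 mC cC); rewrite -cJ subset_leq_card.
Qed.

(** The relation for sets of size [i] contains [B C x i] with coefficient 1 and
    no [B C x j] with [i < j]. *)
Lemma mds_B_determined C v w : weight_mds C ->
  (forall i, i < n - \dim C -> B C v i = B C w i) ->
  forall i, i <= n -> B C v i = B C w i.
Proof.
move=> mC low; elim/ltn_ind => i IH lein.
have [/low //|ge_i] := ltnP i (n - \dim C).
have iN : i < n.+1 by [].
have : \sum_(j < n.+1) B C v j * 'C(n - j, n - i) =
       \sum_(j < n.+1) B C w j * 'C(n - j, n - i).
  rewrite -!sum_agree_off //; apply: eq_bigr => J /eqP cJ.
  by rewrite !(agree_off_const _ mC) ?cJ.
rewrite (bigD1 (Ordinal iN)) //= [\sum_(j < n.+1) B C w _ * _](bigD1 (Ordinal iN)) //=.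
rewrite binn !muln1.
suffices -> : \sum_(j < n.+1 | j != Ordinal iN) B C v j * 'C(n - j, n - i) =
              \sum_(j < n.+1 | j != Ordinal iN) B C w j * 'C(n - j, n - i).
  by move/addIn.
apply: eq_bigr => j; rewrite -val_eqE /= => ne_ji.
have [lt_ji|lt_ij|eji] := ltngtP j i; last by rewrite eji eqxx in ne_ji.
  by rewrite IH // (leq_trans (ltnW lt_ji)).
by rewrite !bin_small ?muln0 //; have := ltn_ord j; lia.
Qed.

Local Open Scope ring_scope.

Lemma uniformly_packed_nat C (beta : nat -> rat) :
  (forall x, \sum_(i < (covering_radius C).+1) beta i * (B C x i)%:R = 1) ->
  uniformly_packed C.
Proof. by move=> sum1; exists (fun i => beta i). Qed.

Lemma covering_radius_le_n C : (covering_radius C <= n)%N.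
Proof. by apply: covering_radius_le => v; apply: dist_le_n. Qed.

(** The coefficients [C(n - i, k) / C(n, k)] come from counting over the sets of
    size [n - k], for each of which exactly one codeword agrees with [x]; they
    vanish beyond distance [n - k]. *)
Lemma mds_uniformly_packed C : weight_mds C -> (n - \dim C <= covering_radius C)%N ->
  uniformly_packed C.
Proof.
move=> mC le_r; have le_kn := dim_le_length C.
pose N : rat := 'C(n, \dim C)%:R.
have N0 : N != 0 by rewrite pnatr_eq0 -lt0n bin_gt0.
apply: (@uniformly_packed_nat C (fun i => 'C(n - i, \dim C)%:R / N)) => x.
have := @sum_agree_off C x (n - \dim C) (leq_subr _ _).
rewrite (eq_bigr (fun=> 1%N)) => [|J /eqP cJ]; last exact: agree_off1.
rewrite sum1dep_card -[LHS]/(#|[set J : {set 'I_n} | _]|) subKn // => sumN.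
rewrite (big_ord_widen n.+1 (fun i => 'C(n - i, \dim C)%:R / N * (B C x i)%:R)); last first.
  by rewrite ltnS covering_radius_le_n.
rewrite big_mkcond /= (eq_bigr (fun i : 'I_n.+1 => (B C x i * 'C(n - i, \dim C))%:R / N)).
  rewrite -mulr_suml -natr_sum -sumN card_draws card_ord bin_sub // divff //.
move=> i _; rewrite natrM; case: ltnP => [_|lt_ri].
  by rewrite mulrAC; congr (_ / N); rewrite mulrC.
rewrite bin_small ?mulr0 ?mul0r //.
have := leq_ltn_trans le_r lt_ri.
by rewrite ltn_subLR // addnC -ltn_subLR // -ltnS.
Qed.

End MDSCodes.

(** * Criteria for uniform packing *)

Section UniformPacking.

Local Open Scope ring_scope.

Lemma solve_triangular (K : fieldType) (m : nat) (A : 'M[K]_m) (b : 'I_m -> K) :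
    (forall i, A i i != 0) -> (forall i j : 'I_m, (j < i)%N -> A i j = 0) ->
  exists g : 'I_m -> K, forall i, \sum_j g j * A i j = b i.
Proof.
move=> Aii trigA.
have unitA : A \in unitmx.
  rewrite unitmxE unitfE -det_tr det_trig; last first.
    by apply/is_trig_mxP=> i j ltij; rewrite mxE trigA.
  by rewrite prodf_seq_neq0; apply/allP=> i _; rewrite mxE Aii.
exists (fun j => (invmx A *m \col_i b i) j 0) => i.
have /colP/(_ i) : A *m (invmx A *m \col_i b i) = \col_i b i by rewrite mulKVmx.
by rewrite !mxE => <-; apply: eq_bigr => j _; rewrite mulrC.
Qed.

Variables (F : finFieldType) (n : nat).
Implicit Types (x y v w e c u : 'rV[F]_n) (C : {vspace 'rV[F]_n}).
Implicit Types (J : {set 'I_n}).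

(** The matrix of the numbers of codewords at distance [j] from a vector that is
    at distance [i] from [C] is triangular with nonzero diagonal, so some
    combination of its columns is constantly 1. *)
Lemma completely_regular_uniformly_packed C :
  completely_regular C -> uniformly_packed C.
Proof.
move=> crC; set r := covering_radius C.
have le_dr v : (dist_to_code v C < r.+1)%N by rewrite ltnS dist_le_covering.
(* For an unattained distance a row of the identity matrix serves as well. *)
pose rep (i : 'I_r.+1) := [pick v | dist_to_code v C == i].
pose A := \matrix_(i, j < r.+1)
  if rep i is Some v then (B C v j)%:R else (i == j)%:R : rat.
have [i|i j lt_ji|g gA] := @solve_triangular _ _ A (fun=> 1).
- rewrite mxE /rep; case: pickP => [v /eqP <-|_]; last by rewrite eqxx oner_eq0.
  by rewrite pnatr_eq0 -lt0n B_dist_gt0.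
- rewrite mxE /rep; case: pickP => [v /eqP dv|_].
    by rewrite B_below_dist // dv.
  by rewrite -val_eqE /= gtn_eqF.
exists g => x; rewrite -[RHS](gA (Ordinal (le_dr x))).
apply: eq_bigr => j _; rewrite mxE /rep; case: pickP => [v /eqP dv|]; last first.
  by move/(_ x); rewrite eqxx.
congr (_ * _%:R); apply: crC => //.
by rewrite -ltnS (leq_trans (ltn_ord j)) // ltnS covering_radius_le_n.
Qed.

Definition dot u x : F := \sum_i u ord0 i * x ord0 i.

Lemma dotDr u x y : dot u (x + y) = dot u x + dot u y.
Proof. by rewrite -big_split; apply: eq_bigr => i _; rewrite mxE mulrDr. Qed.

Lemma dotDl u v x : dot (u + v) x = dot u x + dot v x.
Proof. by rewrite -big_split; apply: eq_bigr => i _; rewrite mxE mulrDl. Qed.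

Lemma dotZl a u x : dot (a *: u) x = a * dot u x.
Proof. by rewrite mulr_sumr; apply: eq_bigr => i _; rewrite mxE mulrA. Qed.

Lemma dotZr a u x : dot u (a *: x) = a * dot u x.
Proof. by rewrite mulr_sumr; apply: eq_bigr => i _; rewrite mxE mulrCA. Qed.

Lemma dot_delta u i : dot u (delta_mx ord0 i) = u ord0 i.
Proof.
rewrite /dot (bigD1 i) //= mxE !eqxx mulr1 big1 ?addr0 // => j /negPf ne_ji.
by rewrite mxE ne_ji andbF mulr0.
Qed.

Definition dual_word C u : Prop := forall c, c \in C -> dot u c = 0.

(** A function of mean zero; composed with [dot u] it plays the role of a sum of
    nontrivial additive characters, with rational values. *)
Definition balanced (t : F) : rat := if t == 0 then #|F|%:R - 1 else - 1.

Lemma sum_balanced : \sum_t balanced t = 0.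
Proof.
rewrite (bigD1 0) //= /balanced eqxx (eq_bigr (fun=> - 1)) => [|t /negPf -> //].
rewrite sumrN sumr_const; have := cardD1 (0 : F) F; rewrite inE /= add1n => ->.
rewrite -natr1 addrK; apply/eqP; rewrite subr_eq0; apply/eqP; congr _%:R.
by apply: eq_card => t; rewrite !inE andbT.
Qed.

Lemma sum_balanced_affine (a s : F) : a != 0 -> \sum_t balanced (s + t * a) = 0.
Proof.
move=> a0; have h_inj : injective (fun t => s + t * a).
  by move=> t1 t2 /addrI /(mulIf a0).
by rewrite -[RHS]sum_balanced [in RHS](reindex_inj h_inj).
Qed.

(** If [J] contains a coordinate where [u] is nonzero, moving along this
    coordinate averages [balanced] over all of [F]. *)
Lemma sum_balanced_dot u J :
  \sum_(e | supp e \subset J) balanced (dot u e) =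
  if [disjoint supp u & J] then (#|F| ^ #|J|)%:R * (#|F|%:R - 1) else 0.
Proof.
case: ifP => [dis|/negbT/pred0Pn[i /andP[/= ui iJ]]].
  rewrite (eq_bigr (fun=> #|F|%:R - 1)) => [|e se].
    by rewrite sumr_const -card_supp_sub cardsE mulr_natl.
  suffices -> : dot u e = 0 by rewrite /balanced eqxx.
  apply: big1 => i _; have [iu|] := boolP (i \in supp u).
    by rewrite (notin_supp se) ?mulr0 // (disjointFr dis).
  by rewrite in_supp negbK => /eqP->; rewrite mul0r.
set S := LHS; have : \sum_(t : F) S = 0.
  rewrite (eq_bigr (fun t => \sum_(e | supp e \subset J)
      balanced (dot u e + t * u ord0 i))) => [|t _].
    rewrite exchange_big big1 // => e _.
    by rewrite sum_balanced_affine // -in_supp.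
  have sd : supp (t *: delta_mx ord0 i : 'rV[F]_n) \subset J.
    apply/supp_subP=> j jJ; rewrite !mxE eqxx /=.
    by case: eqP jJ => [->|_ _]; rewrite ?iJ ?mulr0.
  rewrite {}/S (reindex_inj (addIr (t *: delta_mx ord0 i))) /=.
  apply: eq_big => [e|e _]; last by rewrite dotDr dotZr dot_delta.
  apply/idP/idP => [se|se]; last exact: supp_add.
  by rewrite -[e](addrK (t *: delta_mx ord0 i)) supp_sub.
move/eqP; rewrite sumr_const -mulr_natl mulf_eq0 pnatr_eq0 => /orP[|/eqP //].
by move=> /eqP /card0_eq /(_ 0); rewrite inE.
Qed.

Lemma sum_balanced_agree_off C u J : dual_word C u ->
  \sum_x balanced (dot u x) * (agree_off C J x)%:R =
  #|C|%:R * \sum_(e | supp e \subset J) balanced (dot u e).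
Proof.
move=> duC.
rewrite (eq_bigr (fun x => \sum_(c in C | supp (x - c) \subset J)
    balanced (dot u x))) => [|x _]; last first.
  by rewrite sumr_const mulr_natr /agree_off cardsE.
rewrite (exchange_big_dep (mem C)) //=; last by move=> x c _ /andP[].
rewrite mulr_natl -sumr_const; apply: eq_bigr => c cC.
rewrite (reindex_inj (addIr c)) /=; apply: eq_big => [e|e _].
  by rewrite addrK cC.
by rewrite dotDr (duC c) // addr0.
Qed.

(** In terms of the counts over sets of size [j], a uniform packing is a
    combination with coefficients [g j].  Pairing it with a dual word of weight
    [n - m] gives [sum_j g_j q^j C(m, j) = 0].  As this holds for each [m] up to
    the covering radius, all [g j] vanish by induction, but the combination has
    value 1. *)
Lemma not_uniformly_packed C :
    (covering_radius C < n)%N ->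
    (forall m, (m <= covering_radius C)%N ->
       exists2 u, dual_word C u & wt u = (n - m)%N) ->
  ~ uniformly_packed C.
Proof.
set r := covering_radius C => lt_rn dualC [beta sum_beta].
have [i|i j lt_ji|g gE] := @solve_triangular _ _
  (\matrix_(i, j < r.+1) 'C(n - i, n - j)%:R : 'M[rat]_r.+1) beta.
- by rewrite mxE binn oner_eq0.
- rewrite mxE bin_small //; have := ltn_ord i; lia.
pose count (j : nat) x := (\sum_(J : {set 'I_n} | #|J| == j) agree_off C J x)%N.
have le_jn (j : 'I_r.+1) : (j <= n)%N by have := ltn_ord j; lia.
have sum_g x : \sum_j g j * (count j x)%:R = 1.
  rewrite -[RHS](sum_beta x).
  rewrite (eq_bigr (fun j : 'I_r.+1 => \sum_(i < n.+1)
      g j * 'C(n - i, n - j)%:R * (B C x i)%:R)) => [|j _]; last first.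
    rewrite /count sum_agree_off // natr_sum mulr_sumr.
    by apply: eq_bigr => i _; rewrite natrM -mulrA [(B C x i)%:R * _]mulrC.
  rewrite exchange_big /=.
  pose b (i : nat) := (\sum_j g j * 'C(n - i, n - j)%:R) * (B C x i)%:R.
  transitivity (\sum_(i < n.+1) b i).
    by apply: eq_bigr => i _; rewrite /b mulr_suml.
  transitivity (\sum_(i < r.+1) b i).
    rewrite (@big_ord_widen _ _ _ r.+1 n.+1 b (ltnW lt_rn)) [RHS]big_mkcond.
    apply: eq_bigr => i _; case: ltnP => // lt_ri.
    rewrite /b big1 ?mul0r // => j _; rewrite bin_small ?mulr0 //.
    by have := ltn_ord i; have := ltn_ord j; lia.
  apply: eq_bigr => i _; congr (_ * _); rewrite -gE.
  by apply: eq_bigr => j _; rewrite mxE.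
have q1 : (#|F|%:R - 1 : rat) != 0.
  by rewrite subr_eq0 pnatr_eq1 neq_ltn finNzRing_gt1 orbT.
have q0 : (#|F|%:R : rat) != 0.
  by rewrite pnatr_eq0 -lt0n (ltn_trans _ (finNzRing_gt1 F)).
have C0 : (#|C|%:R : rat) != 0.
  by rewrite pnatr_eq0 -lt0n; apply/card_gt0P; exists 0; rewrite mem0v.
have sum_zeros (m : nat) : (m <= r)%N ->
    \sum_j g j * (#|F| ^ j)%:R * 'C(m, j)%:R = 0.
  move=> le_mr; have [u duC wu] := dualC m le_mr.
  have count_u (j : 'I_r.+1) : \sum_x balanced (dot u x) * (count j x)%:R =
      #|C|%:R * (#|F|%:R - 1) * ((#|F| ^ j)%:R * 'C(m, j)%:R).
    under eq_bigr => x _ do rewrite natr_sum mulr_sumr.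
    rewrite exchange_big /=.
    under eq_bigr => J _ do rewrite sum_balanced_agree_off // sum_balanced_dot.
    rewrite -mulr_sumr -mulrA; congr (_ * _); rewrite -big_mkcondr /=.
    rewrite (eq_bigr (fun=> (#|F| ^ j)%:R * (#|F|%:R - 1))) => [|J]; last first.
      by case/andP=> /eqP->.
    rewrite sumr_const -[LHS]mulr_natr mulrA [(#|F|%:R - 1) * _]mulrC; congr (_ * _%:R).
    have -> : m = #|~: supp u|.
      by rewrite [RHS]cardsCs setCK card_ord -/(wt u) wu subKn //; lia.
    rewrite -cards_draws; apply: eq_card => J.
    by rewrite inE unfold_in andbC disjoint_sym disjoints_subset.
  have : \sum_x balanced (dot u x) * \sum_j g j * (count j x)%:R = 0.
    under eq_bigr => x _ do rewrite sum_g mulr1.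
    rewrite (eq_bigl (fun x => supp x \subset setT)) => [|x]; last by rewrite subsetT.
    rewrite sum_balanced_dot disjoints_subset setCT subset0 supp_eq0 -wt_eq0 wu.
    by case: eqP => //; lia.
  under eq_bigr => x _ do rewrite mulr_sumr.
  rewrite exchange_big /=.
  under eq_bigr => j _ do under eq_bigr => x _ do rewrite mulrCA.
  under eq_bigr => j _ do rewrite -mulr_sumr count_u mulrCA.
  rewrite -mulr_sumr => /eqP; rewrite !mulf_eq0 (negPf C0) (negPf q1) /=.
  move/eqP => sum0; rewrite -[RHS]sum0.
  by apply: eq_bigr => j _; rewrite mulrA.
have g0 (j : 'I_r.+1) : g j = 0.
  case: j; elim/ltn_ind => j IH ltj; set oj := Ordinal ltj.
  have := sum_zeros j ltj; rewrite (bigD1 oj) //= binn mulr1 big1 => [|i].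
    rewrite addr0 => /eqP; rewrite mulf_eq0 pnatr_eq0 expn_eq0.
    by rewrite -(pnatr_eq0 rat) (negPf q0) orbF => /eqP.
  rewrite -val_eqE /= => ne_ij; have [lt_ij|lt_ji|/eqP] := ltngtP i j.
  - by case: i lt_ij {ne_ij} => i lti /= /IH->; rewrite !mul0r.
  - by rewrite bin_small ?mulr0.
  by rewrite (negPf ne_ij).
have := sum_g 0; rewrite big1 => [/eqP|j _]; last by rewrite g0 mul0r.
by rewrite eq_sym oner_eq0.
Qed.

End UniformPacking.

(** * The weights of the dual of an MDS code *)

Section DualWeights.

Local Open Scope ring_scope.

Variables (F : finFieldType) (n : nat).
Implicit Types (x y v w e c u : 'rV[F]_n) (C : {vspace 'rV[F]_n}).
Implicit Types (J R : {set 'I_n}).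

Lemma dot_eq0 u x : [disjoint supp u & supp x] -> dot u x = 0.
Proof.
move=> dis; apply: big1 => i _; have [iu|] := boolP (i \in supp u).
  by have := disjointFr dis iu; rewrite in_supp => /negbFE/eqP->; rewrite mulr0.
by rewrite in_supp negbK => /eqP->; rewrite mul0r.
Qed.

(** A word of [C] can be prescribed to be a unit vector on the support of [u]. *)
Lemma mds_dual_distance C u : weight_mds C -> dual_word C u ->
  (wt u <= \dim C)%N -> u = 0.
Proof.
move=> mC duC wu; apply/eqP; rewrite -supp_eq0.
apply/set0Pn=> -[i iu].
have [|c cC sc] := @mds_interpolation _ _ C (~: supp u) (delta_mx ord0 i) mC.
  by rewrite [#|~: _|]cardsCs setCK card_ord leq_sub2l.
have := dot_delta u i; rewrite -[delta_mx _ _](subrK c) dotDr (duC c) // addr0.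
rewrite dot_eq0; last by rewrite disjoint_sym disjoints_subset.
by move/eqP; rewrite eq_sym; apply/negP; rewrite -in_supp.
Qed.

(** On the set [R] minus one point [i], a codeword is determined by its values, so
    its value at [i] is a linear function of them: this is a dual word [u] with
    [u_i = 1].  Its support cannot be smaller than [R] by [mds_dual_distance]. *)
Lemma mds_dual_word_supp C R : weight_mds C -> #|R| = (\dim C).+1 ->
  exists2 u, dual_word C u & supp u = R.
Proof.
move=> mC cR; have /card_gt0P[i iR] : (0 < #|R|)%N by rewrite cR.
have cR1 : #|R :\ i| = \dim C by have := cardsD1 i R; rewrite iR cR => -[].
pose J := ~: (R :\ i).
have cJ : #|J| = (n - \dim C)%N by rewrite [LHS]cardsCs setCK card_ord cR1.
have [l|b bC sb] := @fin_all_exists2 _ _ (fun _ b => b \in C)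
  (fun l b => supp (delta_mx ord0 l - b : 'rV[F]_n) \subset J).
  by apply: mds_interpolation; rewrite ?cJ.
pose u : 'rV[F]_n :=
  \row_l if l == i then 1 else if l \in R then - b l ord0 i else 0.
have su : supp u \subset R.
  by apply/supp_subP=> l lR; rewrite mxE (negPf lR); case: eqP lR => // ->; rewrite iR.
have duC : dual_word C u.
  move=> c cC; pose s := \sum_(l in R :\ i) c ord0 l *: b l.
  have cs : c = s.
    apply/eqP; rewrite -subr_eq0; apply/eqP/(mds_eq0 mC).
      by rewrite memvB // memv_suml // => l _; rewrite memvZ.
    rewrite -cJ subset_leq_card //; apply/supp_subP=> j.
    rewrite /J inE negbK => jR; rewrite !mxE summxE (bigD1 j) //=.
    have bj l : b l ord0 j = (j == l)%:R.
      have jJ : j \notin J by rewrite inE negbK.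
      by have /eqP := notin_supp (sb l) jJ; rewrite !mxE eqxx /= subr_eq0 => /eqP.
    rewrite big1 ?addr0 => [|l /andP[_ /negPf ne_lj]].
      by rewrite mxE bj eqxx mulr1 subrr.
    by rewrite mxE bj eq_sym ne_lj mulr0.
  have ci : c ord0 i = \sum_(l in R :\ i) c ord0 l * b l ord0 i.
    by rewrite {1}cs summxE; apply: eq_bigr => l _; rewrite mxE.
  rewrite /dot (bigD1 i) //= mxE eqxx mul1r ci [X in X + _]big_mkcond /=.
  rewrite [X in X + _](bigD1 i) //= setD11 add0r -big_split big1 //= => l li.
  rewrite mxE (negPf li) !inE li /=; case: (l \in R); last by rewrite mul0r addr0.
  by rewrite mulNr mulrC subrr.
exists u => //; apply/eqP; rewrite eqEcard su cR ltnNge.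
apply/negP=> /(mds_dual_distance mC duC) u0.
by have /eqP := congr1 (fun z : 'rV_n => z ord0 i) u0; rewrite !mxE eqxx oner_eq0.
Qed.

(** Induction on the weight.  Given a word [a] with [a_i = 0], add a multiple [t b]
    of a dual word [b] of weight [k + 1] whose support consists of [i] and [k]
    points of the support of [a].  At most [k] nonzero values of [t] cancel a
    coordinate, and [k < q - 1]. *)
Lemma mds_dual_weights C (w : nat) : weight_mds C -> (\dim C + 2 <= #|F|)%N ->
  (\dim C < w <= n)%N -> exists2 u, dual_word C u & wt u = w.
Proof.
move=> mC le_q /andP[]; elim: w => // w IH; rewrite ltnS leq_eqVlt.
case/predU1P=> [<- lekn|ltkw ltwn].
  have [|R _ cR] := @exists_superset _ (set0 : {set 'I_n}) (\dim C).+1.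
    by rewrite cards0 card_ord.
  by have [u duC su] := mds_dual_word_supp mC cR; exists u; rewrite // /wt su.
have [a daC wa] := IH ltkw (ltnW ltwn).
have /card_gt0P[i] : (0 < #|~: supp a|)%N.
  by rewrite [#|_|]cardsCs setCK card_ord -/(wt a) wa subn_gt0.
rewrite inE => ia.
have [|K sK cK] := @exists_superset _ (~: supp a) (n - \dim C).
  by rewrite [#|_|]cardsCs setCK card_ord -/(wt a) wa leq_sub2l ?leq_subr // ltnW.
have sKa : ~: K \subset supp a by rewrite -[supp a]setCK setCS.
have [|b dbC sb] := @mds_dual_word_supp C (i |: ~: K) mC.
  rewrite cardsU1 cardsCs setCK card_ord cK subKn ?dim_le_length //.
  by rewrite (contra (subsetP sKa i)).
have lt_q : (1 + \dim C < #|F|)%N by lia.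
(* Excluding 0 keeps [i] in the support of [a + t b]. *)
pose bad := 0 |: [set - a ord0 j / b ord0 j | j in ~: K].
have /card_gt0P[t] : (0 < #|~: bad|)%N.
  rewrite [#|_|]cardsCs setCK subn_gt0.
  apply: leq_ltn_trans (leq_card_setU _ _) _; rewrite cards1.
  apply: leq_ltn_trans (leq_add (leqnn 1) (leq_imset_card _ _)) _.
  rewrite [#|~: K|]cardsCs setCK card_ord cK subKn ?dim_le_length //; exact: lt_q.
rewrite !inE negb_or => /andP[t0 tK].
exists (a + t *: b).
  by move=> c cC; rewrite dotDl dotZl daC // dbC // mulr0 addr0.
rewrite /wt (_ : supp _ = i |: supp a) ?cardsU1 ?ia -/(wt a) ?wa //.
apply/setP=> j; rewrite 2!inE in_set1 !mxE in_supp.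
have [->|ne_ji] /= := eqVneq j i.
  move: ia; rewrite in_supp negbK => /eqP->; rewrite add0r mulf_neq0 //.
  by rewrite -in_supp sb setU11.
have [jK|jK] := boolP (j \in ~: K).
  have bj : b ord0 j != 0 by rewrite -in_supp sb inE jK orbT.
  have aj : a ord0 j != 0 by rewrite -in_supp (subsetP sKa).
  rewrite aj; apply: contraNneq tK => abt; apply/imsetP; exists j => //.
  by apply: (mulIf bj); rewrite divfK //; apply/eqP; rewrite -addr_eq0 addrC abt.
suffices -> : b ord0 j = 0 by rewrite mulr0 addr0.
by apply/eqP; rewrite -[_ == _]negbK -in_supp sb !inE negb_or ne_ji -in_setC.
Qed.

Lemma wtE x : wt x = (\sum_i (x ord0 i != 0%R))%N.
Proof.
rewrite /wt -sum1_card big_mkcond; apply: eq_bigr => i _.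
by rewrite in_supp; case: eqP.
Qed.

End DualWeights.

(** * The covering radius and the extension of an MDS code *)

Section Extension.

Local Open Scope ring_scope.

Variables (F : finFieldType) (n : nat).
Implicit Types (x y v w e c u : 'rV[F]_n) (C : {vspace 'rV[F]_n}).

Lemma wt_row_mx m x (y : 'rV[F]_m) : wt (row_mx x y) = (wt x + wt y)%N.
Proof.
rewrite !wtE big_split_ord /=; congr (_ + _)%N; apply: eq_bigr => i _.
  by rewrite row_mxEl.
by rewrite row_mxEr.
Qed.

Definition pad_fun : 'Hom('rV[F]_n, 'rV[F]_(n + 1)) :=
  linfun (mulmxr (row_mx 1%:M 0)).

Lemma pad_funE c : pad_fun c = row_mx c 0.
Proof. by rewrite lfunE /= mul_mx_row mulmx1 mulmx0. Qed.

(** Up to the sign of the last coordinate, the code whose parity check matrix is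
    that of [C] with the syndrome of [v] as an additional column. *)
Definition extend_code C v : {vspace 'rV[F]_(n + 1)} :=
  (pad_fun @: C + <[row_mx v (const_mx 1%R)]>)%VS.

Lemma extend_codeP C v z : z \in extend_code C v ->
  exists2 c, c \in C & exists t, z = row_mx (c + t *: v) (const_mx t).
Proof.
case/memv_addP=> _ /memv_imgP[c cC ->] [_ /vlineP[t ->] ->]; exists c => //.
exists t; rewrite pad_funE scale_row_mx add_row_mx add0r; congr row_mx.
by apply/rowP=> i; rewrite !mxE mulr1.
Qed.

Lemma dim_extend_code C v : \dim (extend_code C v) = (\dim C + 1)%N.
Proof.
have v1 : row_mx v (const_mx 1) != 0 :> 'rV[F]_(n + 1).
  apply/eqP=> /rowP/(_ (rshift n ord0)); rewrite row_mxEr !mxE => /eqP.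
  by rewrite oner_eq0.
rewrite /extend_code dimv_disjoint_sum ?dim_vline ?v1.
  congr (_ + _)%N; apply: limg_dim_eq; apply/eqP; rewrite -subv0.
  apply/subvP=> c; rewrite memv_cap memv_ker memv0 pad_funE => /andP[_].
  by rewrite -[X in _ == X]row_mx0 => /eqP/eq_row_mx[->].
apply/eqP; rewrite -subv0; apply/subvP=> z; rewrite memv_cap memv0.
case/andP=> /memv_imgP[c _ ->] /vlineP[t]; rewrite pad_funE scale_row_mx.
case/eq_row_mx=> ->.
by move/rowP/(_ ord0); rewrite !mxE mulr1 => <-; rewrite scale0r row_mx0.
Qed.

(** For [t <> 0] the word [c + t v] is a multiple of the difference of [v] and a
    codeword. *)
Lemma mds_extend_code C v : weight_mds C -> (n - \dim C <= dist_to_code v C)%N ->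
  weight_mds (extend_code C v).
Proof.
move=> mC far z /extend_codeP[c cC [t ->]]; rewrite dim_extend_code subnDr wt_row_mx.
have [->|t0 _] := eqVneq t 0.
  rewrite scale0r addr0 => z0; rewrite ltn_addr // mC //.
  by apply: contraNneq z0 => ->; rewrite row_mx0.
have -> : wt (const_mx t : 'rV[F]_1) = 1%N.
  by rewrite wtE big_ord1 mxE t0.
rewrite addn1 ltnS; apply: leq_trans far _.
have cC' : - t^-1 *: c \in C by rewrite memvZ.
apply: leq_trans (dist_le v cC') _; rewrite hdistE scaleNr opprK.
rewrite subset_leq_card //; apply/supp_subP=> i; rewrite in_supp negbK !mxE => /eqP ct0.
by apply: (mulfI t0); rewrite mulr0 mulrDr mulVKf // addrC.
Qed.

End Extension.

(** Otherwise [extend_code] gives a nontrivial MDS code of length [q + 2] and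
    dimension [k + 1], against the conjecture. *)
Lemma covering_radius_lt_redundancy
    (F : finFieldType) (C : {vspace 'rV[F]_(#|F| + 1)}) :
    MDS_conjecture -> weight_mds C -> 2 <= \dim C <= #|F| - 1 ->
    ~ (\dim C = 2 /\ ~~ odd #|F|) -> ~ (\dim C = #|F| - 2 /\ ~~ odd #|F|) ->
  covering_radius C < #|F| + 1 - \dim C.
Proof.
move=> mdsC mC /andP[ge2 leq1] not2 notq2.
suffices far v : dist_to_code v C < #|F| + 1 - \dim C.
  have : covering_radius C <= (#|F| + 1 - \dim C).-1.
    by apply: covering_radius_le => v; have := far v; lia.
  lia.
rewrite ltnNge; apply/negP=> /(mds_extend_code mC) mE.
have dE := dim_extend_code C v; set E := extend_code C v in mE dE.
have ME : MDS E by apply: mds_MDS; rewrite // dE addn1.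
have := mdsC F _ (\dim C + 1) _ E (conj dE erefl).
have ntE : nontrivial_MDS E by split=> //; rewrite dE; lia.
move=> /(_ ntE).
case: ifP => [/andP[evenF k3] _|_]; last by lia.
case/orP: k3 => /eqP k3; [apply: not2 | apply: notq2]; split=> //; lia.
Qed.

(** * Redundancy two: Hamming codes *)

Section RedundancyTwo.

Local Open Scope ring_scope.

Variables (F : finFieldType) (n : nat).
Notation q := #|F|.
Implicit Types (x y v w e c u : 'rV[F]_n) (C : {vspace 'rV[F]_n}).

(** Suppose that [x] is at distance at least 2 and fix a coordinate [i0].  For
    each of the [n - 1 >= q] other coordinates [j], a codeword [c_j] agrees with
    [x] off [i0] and [j].  The differences [x - c_j] take nonzero values at
    [i0], so two of them agree there; then the two codewords coincide and differ
    from [x] at [i0] only. *)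
Lemma redundancy2_covering_radius C :
    weight_mds C -> (n - \dim C = 2)%N -> (q < n)%N ->
  covering_radius C = 1%N.
Proof.
move=> mC dC lt_qn; have q_gt1 : (1 < q)%N := finNzRing_gt1 F.
pose i0 : 'I_n := Ordinal (leq_ltn_trans (leq0n q) lt_qn).
apply/eqP; rewrite eqn_leq; apply/andP; split; last first.
  pose e : 'rV[F]_n := delta_mx ord0 i0.
  have we : wt e = 1%N by rewrite /wt supp_delta cards1.
  apply: leq_trans (dist_le_covering e C); apply/dist_geP => [|c cC]; first by lia.
  rewrite hdistE lt0n wt_eq0 subr_eq0; apply: contraTneq cC => <-.
  apply/negP=> /mC; rewrite dC we -wt_eq0 we => /(_ isT); lia.
apply: covering_radius_le => x; rewrite leqNgt; apply/negP=> far.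
have light c : c \in C -> (1 < wt (x - c))%N.
  by move=> cC; rewrite -hdistE (leq_trans far) ?dist_le.
have [j|c cC sc] := @fin_all_exists2 _ _ (fun _ c => c \in C)
  (fun j c => j != i0 -> supp (x - c) \subset [set i0; j]).
  have [->|ji] := eqVneq j i0; first by exists 0; rewrite ?mem0v.
  have [|c cC sc] := @mds_interpolation _ _ C [set i0; j] x mC; last by exists c.
  by rewrite cards2 eq_sym ji dC.
pose f j := (x - c j) ord0 i0.
have f_neq0 j : j != i0 -> f j != 0.
  move=> ji; apply/eqP=> fj0; have := light _ (cC j); rewrite ltnNge => /negP[].
  rewrite -[X in (_ <= X)%N](cards1 j) subset_leq_card //; apply/supp_subP=> i.
  rewrite inE => ne_ij; have [->//|ne_i0] := eqVneq i i0.
  by apply: (notin_supp (sc j ji)); rewrite !inE negb_or ne_i0.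
have f_inj : {in [set~ i0] &, injective f}.
  move=> j l; rewrite !inE => ji li fjl; apply/eqP; apply: contraT => jl.
  have cjl : c j = c l.
    apply/eqP; rewrite -subr_eq0; apply/eqP; apply: (mds_eq0 mC).
      by rewrite memvB.
    have -> : (n - \dim C)%N = #|[set j; l]| by rewrite dC cards2 jl.
    rewrite subset_leq_card //; apply/supp_subP=> i.
    rewrite !inE negb_or => /andP[ij il].
    have -> : (c j - c l) ord0 i = (x - c l) ord0 i - (x - c j) ord0 i.
      by rewrite !mxE opprB [RHS]addrC addrA subrK.
    have [->|ii0] := eqVneq i i0; first by rewrite -/(f l) -/(f j) fjl subrr.
    rewrite (notin_supp (sc j ji)) ?(notin_supp (sc l li)) ?subrr //.
      by rewrite !inE negb_or ii0.
    by rewrite !inE negb_or ii0.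
  have := light _ (cC j); rewrite ltnNge => /negP[].
  rewrite -[X in (_ <= X)%N](cards1 i0) subset_leq_card //.
  apply/supp_subP=> i; rewrite inE => ii0.
  have [ij|ij] := eqVneq i j; last first.
    by apply: (notin_supp (sc j ji)); rewrite !inE negb_or ii0.
  by rewrite cjl; apply: (notin_supp (sc l li)); rewrite !inE negb_or ii0 ij.
have := card_in_imset f_inj; rewrite cardsC1 card_ord => cf.
have : (#|f @: [set~ i0]| <= #|[set~ (0%R : F)]|)%N.
  apply: subset_leq_card; apply/subsetP=> y /imsetP[j]; rewrite !inE => ji ->.
  exact: f_neq0.
rewrite cf cardsC1 => cF; have : (n.-1 <= q.-1)%N := cF; lia.
Qed.

Lemma redundancy2_completely_regular C :
    weight_mds C -> (n - \dim C = 2)%N -> (q < n)%N ->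
  completely_regular C.
Proof.
move=> mC dC lt_qn; have q_gt1 : (1 < q)%N := finNzRing_gt1 F; move=> v w t le_t dvw.
have MC : min_dist C = 3%N.
  by rewrite mds_MDS ?dC //; have := dim_le_length C; lia.
have dist1 := dist_le_covering v C; rewrite redundancy2_covering_radius // in dist1.
apply: (mds_B_determined mC) le_t => i; rewrite dC => lti.
by rewrite !B_within_min_dist ?MC -?dvw //; lia.
Qed.

End RedundancyTwo.

(** * Redundancy three: arcs of q + 1 points in planes of even order *)

Lemma cards3 (T : finType) (x y z : T) :
  uniq [:: x; y; z] -> #|[set x; y; z]| = 3.
Proof.
by move=> /card_uniqP U; rewrite -[RHS]U; apply: eq_card => t; rewrite !inE orbA.
Qed.

Lemma cards4 (T : finType) (x y z t : T) :
  uniq [:: x; y; z; t] -> #|[set x; y; z; t]| = 4.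
Proof.
by move=> /card_uniqP U; rewrite -[RHS]U; apply: eq_card => u; rewrite !inE -!orbA.
Qed.

Section Tangents.

Local Open Scope ring_scope.

Variables (F : finFieldType) (n : nat).
Notation q := #|F|.
Implicit Types (x y v w e c u : 'rV[F]_n) (C : {vspace 'rV[F]_n}).

(** For redundancy 3 the syndromes form a projective plane, in which the columns of
    a parity check matrix are an arc.  These codewords stand for the secants
    through the syndrome of [y] and the point [a] of the arc. *)
Definition pairs_through C y (a : 'I_n) : {set 'rV[F]_n} :=
  [set c | [&& c \in C, hdist y c == 2%N & a \in supp (y - c)]].

Lemma sum_pairs_through C y : (\sum_a #|pairs_through C y a| = 2 * B C y 2)%N.
Proof.
transitivity (\sum_a \sum_(c | [&& c \in C, hdist y c == 2 & a \in supp (y - c)]) 1)%N.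
  by apply: eq_bigr => a _; rewrite sum1dep_card.
rewrite (exchange_big_dep (fun c => (c \in C) && (hdist y c == 2)%N)) /=; last first.
  by move=> a c _ /and3P[-> ->].
rewrite mulnC -sum_nat_const; apply: eq_big => [c|c /andP[cC dc]]; first by rewrite inE.
rewrite cC dc /= -[RHS](eqP dc) hdistE /wt -sum1_card.
by apply: eq_bigl => a.
Qed.

(** Two supports of size 2 that share a point have a union of size at most 3, less
    than the minimum distance 4. *)
Lemma pairs_through_inj C y a : weight_mds C -> (n - \dim C = 3)%N ->
  {in pairs_through C y a &, forall c d, c = d}.
Proof.
move=> mC dC c d; rewrite !inE !hdistE => /and3P[cC /eqP wc ac] /and3P[dD /eqP wd ad].
apply/eqP; rewrite -subr_eq0; apply/eqP; apply: (mds_eq0 mC); first by rewrite memvB.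
have sub : supp (c - d) \subset supp (y - c) :|: supp (y - d).
  have -> : c - d = (y - d) - (y - c) by rewrite opprB [RHS]addrC addrA subrK.
  by rewrite supp_sub ?subsetUl ?subsetUr.
rewrite dC; apply: leq_trans (subset_leq_card sub) _.
have : (0 < #|supp (y - c) :&: supp (y - d)|)%N.
  by apply/card_gt0P; exists a; rewrite in_setI !in_supp ac ad.
by rewrite cardsU -/(wt (y - c)) -/(wt (y - d)) wc wd; lia.
Qed.

Lemma pairs_through_le1 C y a : weight_mds C -> (n - \dim C = 3)%N ->
  (#|pairs_through C y a| <= 1)%N.
Proof.
move=> mC dC; apply/card_le1_eqP=> c d cc cd.
exact: (pairs_through_inj mC dC cd cc).
Qed.

(** The supports of the differences are disjoint pairs in a set of odd size
    [q + 1]: through each point passes at least one tangent. *)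
Lemma double_B2_le C y : weight_mds C -> (n - \dim C = 3)%N -> n = (q + 1)%N ->
  ~~ odd q -> (2 * B C y 2 <= q)%N.
Proof.
move=> mC dC nq evq; have : (2 * B C y 2 <= n)%N.
  rewrite -sum_pairs_through -[X in (_ <= X)%N]card_ord -sum1_card leq_sum // => a _.
  exact: pairs_through_le1.
by lia.
Qed.

Definition pair_word (i j : 'I_n) (a b : F) : 'rV[F]_n :=
  a *: delta_mx ord0 i + b *: delta_mx ord0 j.

Lemma pair_wordE i j a b l : pair_word i j a b ord0 l =
  (if l == i then a else 0) + (if l == j then b else 0).
Proof.
by rewrite !mxE !eqxx /=; do 2!case: eqP => _; rewrite ?mulr1 ?mulr0.
Qed.

(** The zero codeword contributes for each nonzero [t]. *)
Lemma sum_pairs_through_end C (i j : 'I_n) (s : F) (a : 'I_n) :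
    i != j -> s != 0 -> a \in [set i; j] ->
  (q - 1 <= \sum_(t | t != 0%R) #|pairs_through C (pair_word i j s t) a|)%N.
Proof.
move=> ij s0 aij.
have <- : (\sum_(t : F | t != 0%R) 1 = q - 1)%N.
  rewrite sum1_card subn1 -(cardC1 (0 : F)); apply: eq_card => t; by rewrite !inE.
apply: leq_sum => t t0; apply/card_gt0P; exists 0.
rewrite inE mem0v hdistE subr0 /wt (_ : supp _ = [set i; j]).
  by rewrite cards2 ij aij.
apply/setP=> l; rewrite in_supp pair_wordE !inE.
have [->|li] /= := eqVneq l i; first by rewrite (negPf ij) /= addr0.
by case: (l == j); rewrite add0r ?t0 ?eqxx.
Qed.

(** For each [b] other than [i], [j] and [a] there is a codeword with support
    [i, j, a, b] and value [s] at [i].  It contributes for the [t] which is its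
    value at [j], and different [b] give different [t] by [pairs_through_inj]. *)
Lemma sum_pairs_through_off C (i j : 'I_n) (s : F) (a : 'I_n) :
    weight_mds C -> (n - \dim C = 3)%N -> i != j -> s != 0 -> a \notin [set i; j] ->
  (n - 3 <= \sum_(t | t != 0%R) #|pairs_through C (pair_word i j s t) a|)%N.
Proof.
move=> mC dC ij s0 aij.
have ia : a != i by apply: contraNneq aij => ->; rewrite !inE eqxx.
have ja : a != j by apply: contraNneq aij => ->; rewrite !inE eqxx orbT.
pose R := ~: [set i; j; a].
have cR : #|R| = (n - 3)%N.
  rewrite [LHS]cardsCs setCK card_ord; congr (_ - _)%N.
  by rewrite cards3 //= !inE negb_or ij !(eq_sym _ a) ia ja.
have [b|w wC sw] := @fin_all_exists2 _ _ (fun _ c => c \in C)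
  (fun b c => b \in R -> supp (s *: delta_mx ord0 i - c) \subset [set j; a; b]).
  have [bR|_] := boolP (b \in R); last by exists 0; rewrite ?mem0v.
  have [|c cC sc] := @mds_interpolation _ _ C [set j; a; b] (s *: delta_mx ord0 i) mC.
    move: bR; rewrite !inE -!orbA !negb_or => /and3P[bi bj ba].
    by rewrite dC cards3 //= !inE negb_or !(eq_sym j) !(eq_sym a b) ja bj ba.
  by exists c.
have wP b : b \in R -> [/\ w b ord0 i = s, w b ord0 j != 0 &
    supp (pair_word i j s (w b ord0 j) - w b) = [set a; b]].
  move=> bR; have := bR; rewrite !inE -!orbA !negb_or => /and3P[bi bj ba].
  have := sw b bR; set c := w b; have cC : c \in C := wC b; move=> sc.
  have c_i : c ord0 i = s.
    have iJ : i \notin [set j; a; b].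
      by rewrite !inE -!orbA !negb_or ij !(eq_sym i) ia bi.
    by have /eqP := notin_supp sc iJ; rewrite !mxE !eqxx mulr1 subr_eq0 eq_sym => /eqP.
  have sc4 : supp c \subset [set i; j; a; b].
    apply/supp_subP=> l; rewrite !inE -!orbA !negb_or => /and4P[li lj la lb].
    have lJ : l \notin [set j; a; b] by rewrite !inE -!orbA !negb_or lj la.
    have /eqP := notin_supp sc lJ; rewrite !mxE (negPf li) andbF mulr0 sub0r oppr_eq0.
    by move/eqP.
  have c4 : #|[set i; j; a; b]| = 4%N.
    by rewrite cards4 //= !inE !negb_or ij !(eq_sym _ a) !(eq_sym _ b) ia ja bi bj ba.
  have sE : supp c = [set i; j; a; b].
    apply/eqP; rewrite eqEcard sc4 c4 /=.
    have := mC c cC; rewrite dC; apply; apply/eqP=> c0.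
    by move: c_i; rewrite c0 mxE => /eqP; rewrite eq_sym (negPf s0).
  have c_j : c ord0 j != 0 by rewrite -in_supp sE !inE eqxx orbT.
  split=> //; apply/setP=> l; rewrite in_supp mxE pair_wordE mxE !inE.
  have [->|li] := eqVneq l i.
    rewrite (negPf ij) /= addr0 c_i subrr eqxx [i == a]eq_sym (negPf ia).
    by rewrite [i == b]eq_sym (negPf bi).
  have [->|lj] := eqVneq l j.
    by rewrite add0r subrr eqxx [j == a]eq_sym (negPf ja) [j == b]eq_sym (negPf bj).
  rewrite !add0r oppr_eq0 -in_supp sE !inE (negPf li) (negPf lj) //.
have wT b : b \in R -> w b \in pairs_through C (pair_word i j s (w b ord0 j)) a.
  move=> bR; have [_ _ sb] := wP b bR.
  rewrite in_set wC hdistE /wt sb cards2 !inE eqxx.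
  move: bR; rewrite !inE -!orbA !negb_or => /and3P[_ _ /negPf ba].
  by rewrite [a == b]eq_sym ba.
pose f b := w b ord0 j.
have f_inj : {in R &, injective f}.
  move=> b d bR dR fbd; have wbd : w b = w d.
    by apply: (pairs_through_inj mC dC (wT b bR)); rewrite -/(f b) fbd wT.
  have [_ _ sb] := wP b bR; have [_ _ sd] := wP d dR.
  have : b \in [set a; d] by rewrite -sd -wbd sb !inE eqxx orbT.
  rewrite !inE; move: bR; rewrite !inE -!orbA !negb_or => /and3P[_ _ /negPf->].
  by move/eqP.
rewrite -cR -(card_in_imset f_inj) -sum1_card.
rewrite [X in (_ <= X)%N]big_mkcond [X in (X <= _)%N]big_mkcond /=.
apply: leq_sum => t _; case: ifP => // /imsetP[b bR ->].
have [_ fb0 _] := wP b bR; rewrite /f fb0; apply/card_gt0P.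
by exists (w b); apply: wT.
Qed.

(** Up to translation and with [i], [j] the support of [v - c], sum over all
    vectors [s e_i + t e_j] with [t <> 0], that is, over the points of a secant
    off the arc.  The two preceding lemmas bound the sum of the [q - 1] terms
    [2 * B] below by [(q - 1) * q], while each term is at most [q]. *)
Lemma double_B2_eq C v : weight_mds C -> (n - \dim C = 3)%N -> n = (q + 1)%N ->
  ~~ odd q -> dist_to_code v C = 2%N -> (2 * B C v 2 = q)%N.
Proof.
move=> mC dC nq evq dv; have [c0 c0C dc0] := dist_attained v C.
rewrite -(B_translate v 2 c0C).
have /cards2P[i [j [ij sij]]] : #|supp (v - c0)| == 2%N.
  by rewrite -/(wt _) -hdistE dc0 dv.
set s := (v - c0) ord0 i; set r := (v - c0) ord0 j.
have s0 : s != 0 by rewrite -in_supp sij !inE eqxx.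
have r0 : r != 0 by rewrite -in_supp sij !inE eqxx orbT.
have -> : v - c0 = pair_word i j s r.
  apply/rowP=> l; rewrite pair_wordE.
  have [->|li] := eqVneq l i; first by rewrite (negPf ij) /= addr0.
  have [->|lj] := eqVneq l j; first by rewrite add0r.
  by rewrite addr0; apply: (notin_supp (subxx _)); rewrite sij !inE negb_or li.
apply/eqP; rewrite eqn_leq double_B2_le //=.
have q1 : (1 < q)%N := finNzRing_gt1 F.
(* [i] and [j] contribute at least [q - 1] each, the [q - 1] other points of the
   arc at least [q - 2] each. *)
have total : ((q - 1) * q <= \sum_(t : F | t != 0%R) 2 * B C (pair_word i j s t) 2)%N.
  under eq_bigr => t _ do rewrite -sum_pairs_through.
  rewrite exchange_big /= (bigID (mem [set i; j])) /=.
  apply: (@leq_trans (\sum_(a in [set i; j]) (q - 1) +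
                      \sum_(a | a \notin [set i; j]) (n - 3))%N).
    rewrite !sum_nat_const cards2 ij /=.
    have -> : #|[pred a | a \notin [set i; j]]| = (n - 2)%N.
      have := cardsCs (~: [set i; j]); rewrite setCK card_ord cards2 ij => <-.
      by apply: eq_card => a; rewrite !inE.
    have [-> ->] : (n - 2 = q - 1)%N /\ (n - 3 = q - 2)%N by lia.
    by rewrite [(2 * _)%N]mulnC -mulnDr subnKC.
  apply: leq_add; apply: leq_sum => a aij.
    exact: sum_pairs_through_end.
  exact: sum_pairs_through_off.
rewrite (bigD1 r) //= in total.
have rest : (\sum_(t | (t != 0%R) && (t != r)) 2 * B C (pair_word i j s t) 2
              <= (q - 2) * q)%N.
  apply: (@leq_trans (\sum_(t : F | (t != 0%R) && (t != r)) q)%N).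
    by apply: leq_sum => t _; apply: double_B2_le.
  rewrite sum_nat_const leq_mul2r; apply/orP; right.
  have := cardsCs (~: [set 0%R; r]); rewrite setCK cards2 eq_sym r0 => cr.
  apply/eq_leq; rewrite -[RHS]cr.
  by apply: eq_card => t; rewrite !inE negb_or.
have split_q m : (1 < m -> (m - 1) * m = m + (m - 2) * m)%N.
  by case: m => [|[|m]] // _; rewrite !subSS !subn0 mulSn.
by have := leq_trans total (leq_add (leqnn _) rest); rewrite (split_q q) // leq_add2r.
Qed.

Lemma redundancy3_completely_regular C : weight_mds C -> (n - \dim C = 3)%N ->
  n = (q + 1)%N -> ~~ odd q -> (0 < \dim C)%N -> completely_regular C.
Proof.
move=> mC dC nq evq k0 v w t le_t dvw.
have MC : min_dist C = 4%N by rewrite mds_MDS ?dC.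
apply: (mds_B_determined mC) le_t => i; rewrite dC => lti.
have [lt_i|ge_i] := ltnP i (dist_to_code v C).
  by rewrite !B_below_dist // -dvw.
have [lt4|ge4] := ltnP (i + dist_to_code v C) 4.
  by rewrite !B_within_min_dist ?MC -?dvw.
have -> : i = 2%N by lia.
have dv : dist_to_code v C = 2%N by lia.
have := double_B2_eq mC dC nq evq dv.
by rewrite -(double_B2_eq mC dC nq evq (etrans (esym dvw) dv)); lia.
Qed.

End Tangents.

(** * Dimension two in even characteristic *)

Section EvenCharacteristic.

Local Open Scope ring_scope.

Variable F : finFieldType.
Notation q := #|F|.

(** [(-1) ^ q] is both [-1] and, for [q] even, [1]. *)
Lemma even_card_pchar2 : ~~ odd q -> 2%:R = 0 :> F.
Proof.
move=> evq; have := expf_card (- 1 : F); rewrite -signr_odd (negPf evq) expr0.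
by move=> E; rewrite -[2%:R]/(1 + 1) {1}E addNr.
Qed.

Lemma even_card_sqrt (a : F) : ~~ odd q -> (a ^+ q./2) ^+ 2 = a.
Proof. by move=> evq; rewrite -exprM muln2 even_halfK // expf_card. Qed.

(** The quadratic form [Q(x, y) = a x^2 - x y + b y^2] has the determinant
    as its polar form in characteristic 2.  Expanding [Q] on the
    relation [D12 p3 = D32 p1 + D13 p2] between three vectors of a plane shows
    that three zeros of [Q] cannot be pairwise independent. *)
Lemma quadric_three_points (a b x1 y1 x2 y2 x3 y3 : F) : 2%:R = 0 :> F ->
    x1 * y1 = a * x1 ^+ 2 + b * y1 ^+ 2 ->
    x2 * y2 = a * x2 ^+ 2 + b * y2 ^+ 2 ->
    x3 * y3 = a * x3 ^+ 2 + b * y3 ^+ 2 ->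
  (x1 * y2 - x2 * y1) * (x1 * y3 - x3 * y1) * (x2 * y3 - x3 * y2) = 0.
Proof.
move=> two0 /eqP; rewrite -subr_eq0 => /eqP E1 /eqP; rewrite -subr_eq0 => /eqP E2.
move=> /eqP; rewrite -subr_eq0 => /eqP E3.
pose D12 := x1 * y2 - x2 * y1; pose D13 := x1 * y3 - x3 * y1.
pose D32 := x3 * y2 - x2 * y3.
transitivity (D32 ^+ 2 * (x1 * y1 - (a * x1 ^+ 2 + b * y1 ^+ 2)) +
    D13 ^+ 2 * (x2 * y2 - (a * x2 ^+ 2 + b * y2 ^+ 2)) -
    D12 ^+ 2 * (x3 * y3 - (a * x3 ^+ 2 + b * y3 ^+ 2)) +
    2%:R * (D32 * D13 * (x2 * y1 - a * x1 * x2 - b * y1 * y2))).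
  by rewrite /D12 /D13 /D32; ring.
by rewrite E1 E2 E3 two0 !mulr0 mul0r subr0 !addr0.
Qed.

Variable n : nat.
Implicit Types (C : {vspace 'rV[F]_n}).

(** With a basis [g], [h] of [C] and the vector [v] of entries [sqrt (g_i h_i)],
    a coordinate where [v] agrees with [a g + b h] satisfies
    [g_i h_i = a^2 g_i^2 + b^2 h_i^2].  The points [(g_i, h_i)] are pairwise
    independent, so this happens at most twice. *)
Lemma even_dim2_covering_radius C : weight_mds C -> \dim C = 2%N -> ~~ odd q ->
  (n - 2 <= covering_radius C)%N.
Proof.
move=> mC dC evq; have le2n : (2 <= n)%N by rewrite -dC dim_le_length.
have separate (i j : 'I_n) : i != j ->
    exists2 c, c \in C & c ord0 i = 1 /\ c ord0 j = 0.
  move=> ij.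
  have [|c cC sc] := @mds_interpolation _ _ C (~: [set i; j]) (delta_mx ord0 i) mC.
    by rewrite cardsCs setCK card_ord cards2 ij dC.
  exists c => //; have [iJ jJ] : i \notin ~: [set i; j] /\ j \notin ~: [set i; j].
    by rewrite !inE !eqxx orbT.
  have /eqP := notin_supp sc iJ; have /eqP := notin_supp sc jJ.
  rewrite !mxE !eqxx [j == i]eq_sym (negPf ij) /= sub0r oppr_eq0 subr_eq0.
  by move=> /eqP-> /eqP <-.
pose s0 : 'I_n := Ordinal (ltnW le2n); pose s1 : 'I_n := Ordinal le2n.
have [g gC [g0 g1]] := separate s0 s1 isT.
have [h hC [h1 h0]] := separate s1 s0 isT.
have expand c : c \in C -> c = c ord0 s0 *: g + c ord0 s1 *: h.
  move=> cC; apply/eqP; rewrite -subr_eq0; apply/eqP/(mds_eq0 mC).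
    by rewrite memvB ?memvD ?memvZ.
  rewrite dC (_ : (n - 2 = #|~: [set s0; s1]|)%N); last first.
    by rewrite [RHS]cardsCs setCK card_ord cards2.
  rewrite subset_leq_card //; apply/supp_subP=> l; rewrite !inE negbK.
  by case/orP=> /eqP->; rewrite !mxE ?g0 ?g1 ?h0 ?h1 !mulr1 !mulr0 ?addr0 ?add0r subrr.
have det_neq0 (i j : 'I_n) : i != j ->
    g ord0 i * h ord0 j - g ord0 j * h ord0 i != 0.
  move=> ij; apply/eqP=> D0.
  have [c cC [ci cj]] := separate i j ij.
  have ji : j != i by rewrite eq_sym.
  have [d dD [dj _]] := separate j i ji.
  move: ci cj dj; rewrite (expand c cC) (expand d dD) !mxE.
  set a := c ord0 s0; set b := c ord0 s1; set a' := d ord0 s0; set b' := d ord0 s1.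
  move: D0; set gi := g ord0 i; set gj := g ord0 j.
  set hi := h ord0 i; set hj := h ord0 j => D0 ci cj dj.
  have /eqP := oner_neq0 F; apply.
  transitivity ((a * gi + b * hi) * (a' * gj + b' * hj)); first by rewrite ci dj mulr1.
  transitivity ((a * gj + b * hj) * (a' * gi + b' * hi) +
     (a * b' - a' * b) * (gi * hj - gj * hi)); first by ring.
  by rewrite cj D0 mul0r mulr0 addr0.
pose v : 'rV[F]_n := \row_i (g ord0 i * h ord0 i) ^+ q./2.
apply: leq_trans (dist_le_covering v C).
apply/dist_geP => [|c cC]; first exact: leq_subr.
rewrite hdistE leqNgt; apply/negP=> light.
have /card_gt2P : (2 < #|~: supp (v - c)|)%N.
  by rewrite cardsCs setCK card_ord -/(wt (v - c)); lia.
case=> i [j [l [[iZ jZ lZ] [ij jl li]]]].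
have onC k : k \in ~: supp (v - c) -> g ord0 k * h ord0 k =
    c ord0 s0 ^+ 2 * g ord0 k ^+ 2 + c ord0 s1 ^+ 2 * h ord0 k ^+ 2.
  rewrite !inE negbK !mxE subr_eq0 => /eqP E.
  rewrite -[LHS](even_card_sqrt _ evq) E {1}(expand c cC) !mxE sqrrD !exprMn.
  by rewrite -mulr_natl even_card_pchar2 // mul0r addr0.
have /eqP := quadric_three_points (even_card_pchar2 evq) (onC i iZ) (onC j jZ) (onC l lZ).
by rewrite !mulf_eq0 !(negPf (det_neq0 _ _ _)) // eq_sym.
Qed.

End EvenCharacteristic.

(** * Doubly extended Reed-Solomon codes *)

Section DoublyExtendedReedSolomon.

Local Open Scope ring_scope.

Variables (F : finFieldType) (k : nat).
Notation q := #|F|.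

(** Polynomials of degree at most [k] are evaluated at all the elements of the
    field and, at infinity, by their coefficient of degree [k]. *)
Definition rs_mx : 'M[F]_(k.+1, q + 1) :=
  row_mx (\matrix_(i, j) enum_val j ^+ i) (\matrix_(i, j) (i == ord_max)%:R).

Definition rs_code : {vspace 'rV[F]_(q + 1)} :=
  limg (linfun (mulmxr rs_mx)).

Lemma rs_encodeE (a : 'rV[F]_k.+1) : a *m rs_mx =
  row_mx (\row_j (rVpoly a).[enum_val j]) (const_mx (a ord0 ord_max)).
Proof.
rewrite mul_mx_row; congr row_mx; apply/rowP=> j; rewrite !mxE.
  rewrite (horner_coef_wide _ (size_poly _ _)).
  by apply: eq_bigr => i _; rewrite mxE coef_rVpoly_ord.
rewrite (bigD1 ord_max) //= mxE eqxx mulr1 big1 ?addr0 // => i /negPf ne.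
by rewrite mxE ne mulr0.
Qed.

(** A polynomial of degree [k] has at most [k] zeros in the field; one of smaller
    degree vanishes at infinity, and has at most [k - 1] zeros in the field. *)
Lemma rs_weight (a : 'rV[F]_k.+1) :
  (k <= q)%N -> a != 0 -> (q - k < wt (a *m rs_mx))%N.
Proof.
move=> le_kq a0; rewrite rs_encodeE wt_row_mx; set p := rVpoly a.
have p0 : p != 0.
  by apply: contraNneq a0 => p0; rewrite -[a]rVpolyK -/p p0 linear0.
set e := \row_j _; have zeros : (#|~: supp e| < size p)%N.
  rewrite cardE -(size_map enum_val); apply: max_poly_roots => //.
    apply/allP=> y /mapP[j]; rewrite mem_enum !inE mxE negbK => pj ->.
    exact: pj.
  by rewrite map_inj_uniq ?enum_uniq //; apply: enum_val_inj.
have we : wt e = (q - #|~: supp e|)%N.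
  by rewrite cardsCs setCK card_ord subKn ?wt_le.
have le_p : (size p <= k.+1)%N by apply: size_poly.
have [am0|am0] := eqVneq (a ord0 ord_max) 0; last first.
  rewrite (_ : wt (const_mx _) = 1%N) ?we; first by lia.
  by rewrite wtE big_ord1 mxE am0.
have : (size p <= k)%N.
  apply/leq_sizeP => j; rewrite leq_eqVlt => /predU1P[<-|ltkj].
    by rewrite (coef_rVpoly_ord a ord_max).
  by rewrite nth_default // (leq_trans le_p).
by rewrite we; lia.
Qed.

Lemma dim_rs_code : (k <= q)%N -> \dim rs_code = k.+1.
Proof.
move=> le_kq; rewrite limg_dim_eq ?dimvf /dim /= ?mul1n //.
apply/eqP; rewrite -subv0; apply/subvP=> a; rewrite memv_cap memv_ker memv0.
case/andP=> _; rewrite lfunE /=; apply: contraTT => /(rs_weight le_kq).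
by rewrite -wt_eq0; case: (wt _).
Qed.

Lemma weight_mds_rs_code : (k <= q)%N -> weight_mds rs_code.
Proof.
move=> le_kq _ /memv_imgP[a _ ->]; rewrite lfunE /= dim_rs_code // => aM.
rewrite (_ : (q + 1 - k.+1 = q - k)%N); last by rewrite addn1 subSS.
by apply: rs_weight => //; apply: contraNneq aM => ->; rewrite mul0mx.
Qed.

End DoublyExtendedReedSolomon.

(** * The classification *)

Theorem theorem18 (mdsC : MDS_conjecture) :
  (forall (F : finFieldType) (k : nat) (C : {vspace 'rV[F]_(#|F| + 1)}),
     let q := #|F| in
     is_code C k (q - k + 2) -> nontrivial_MDS C ->
     [/\ ~ [\/ k = q - 1,
               k = 2 /\ (~~ odd q \/ q = 3)
             | k = q - 2 /\ ~~ odd q] ->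
           ~ uniformly_packed C /\ ~ completely_regular C,
         k = q - 1 ->
           [/\ uniformly_packed C, Hamming_code C, perfect C
             & completely_regular C],
         k = 2 /\ (~~ odd q \/ q = 3) ->
           uniformly_packed C /\ (q = 3 -> completely_regular C)
       & k = q - 2 /\ ~~ odd q -> uniformly_packed C])
  /\
  (forall (m : nat) (F : finFieldType), 1 < m -> #|F| = 2 ^ m ->
     exists C : {vspace 'rV[F]_(#|F| + 1)},
       is_code C (#|F| - 2) 4 /\ completely_regular C).
Proof.
split=> [F k C q [dC _] [MC /andP[ge2 le_k]]|m F m_gt1 qE].
  have mC : weight_mds C by apply: MDS_mds MC; apply: ltnW.
  rewrite dC in ge2 le_k; have lt_qn : q < q + 1 by rewrite addn1.
  have redundancy : q + 1 - \dim C = q + 1 - k by rewrite dC.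
  have q_ge3 : 2 < q by rewrite /q; lia.
  have hamming : k = q - 1 -> completely_regular C.
    by move=> kE; apply: redundancy2_completely_regular; rewrite // redundancy kE; lia.
  split.
  - move=> not_exc.
    have not_up : ~ uniformly_packed C.
      have lt_r : covering_radius C < q + 1 - \dim C.
        apply: covering_radius_lt_redundancy; rewrite // dC.
        + by rewrite ge2 /= -/q; lia.
        + by case=> k2 evq; apply: not_exc; apply: Or32; split=> //; left.
        + by move=> kq; apply: not_exc; apply: Or33.
      apply: not_uniformly_packed => [|j le_j]; first by lia.
      apply: mds_dual_weights => //; rewrite dC; last by lia.
      have : k <> q - 1 by move=> kE; apply: not_exc; apply: Or31.
      by rewrite -/q; lia.
    by split=> // /completely_regular_uniformly_packed.
  - move=> kE; have crC := hamming kE.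
    have r1 : covering_radius C = 1.
      by apply: redundancy2_covering_radius; rewrite // redundancy kE; lia.
    have e1 : packing_radius C = 1.
      by rewrite /packing_radius MC redundancy kE (_ : q + 1 - (q - 1) = 2) //; lia.
    have pC : perfect C by rewrite /perfect e1 r1.
    by split=> //; apply: completely_regular_uniformly_packed.
  - case=> k2 [evq|q3].
      split=> [|q3]; last by rewrite q3 in evq.
      apply: mds_uniformly_packed => //; rewrite dC k2.
      by apply: even_dim2_covering_radius; rewrite ?dC.
    have crC : completely_regular C by apply: hamming; lia.
    by split=> //; apply: completely_regular_uniformly_packed.
  case=> kE evq; apply: completely_regular_uniformly_packed.
  by apply: redundancy3_completely_regular; rewrite ?redundancy ?dC // kE; lia.
(* Degree [q - 3] gives dimension [q - 2] and redundancy 3. *)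
have q_ge4 : 3 < #|F| by rewrite qE (leq_trans _ (leq_pexp2l _ m_gt1)).
have evq : ~~ odd #|F| by rewrite qE oddX; case: m m_gt1 {qE}.
have mC : weight_mds (rs_code F (#|F| - 3)).
  by apply: weight_mds_rs_code; rewrite leq_subr.
have dC : \dim (rs_code F (#|F| - 3)) = #|F| - 2.
  by rewrite dim_rs_code ?leq_subr //; lia.
exists (rs_code F (#|F| - 3)); split.
  split=> //; rewrite mds_MDS // dC; lia.
by apply: redundancy3_completely_regular; rewrite ?dC //; lia.
Qed.
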